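(* For every topological space $X$ there is a Tychonoff space $Z$ such that $X\times Z$ is DH$^+$-separable.
   Context: A subset of a space is called discrete if it is discrete in its subspace topology. A space $Y$ is DH$^+$-separable if player Two has a winning strategy in the following game of length $\omega$ on $Y$: at inning $n$, One picks a dense $D_n\subset Y$, then Two picks a discrete set $F_n\subset D_n$; Two wins if every non-empty open set in $Y$ intersects all but finitely many $F_n$. *)

(* Defs.v *)
From HB Require Import structures.
From mathcomp Require Import all_boot all_order all_algebra.
From mathcomp Require Import all_classical all_reals all_analysis.

Set Implicit Arguments.
Unset Strict Implicit.
Unset Printing Implicit Defensive.

Local Open Scope classical_set_scope.

(* The topology on [set_type A] is the initial topology of its inclusion in T. *)
Definition discrete_subset (T : topologicalType) (A : set T) : Prop :=
  forall U : set (set_type A), open U.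

(* [completely_regular_space] is phrased with uniformities; by
   [uniform_separatorP] it is the separation of points from closed sets by
   continuous functions into [0, 1]. *)
Definition tychonoff_space (T : topologicalType) : Prop :=
  hausdorff_space T /\ completely_regular_space T.

(* A strategy of Two answers the history D_0, ..., D_n of the moves of One. *)
Definition strategy_Two (Y : topologicalType) : Type := seq (set Y) -> set Y.

Definition reply (Y : topologicalType) (s : strategy_Two Y) (D : nat -> set Y)
  (n : nat) : set Y := s (mkseq D n.+1).

Definition winning_DHplus (Y : topologicalType) (s : strategy_Two Y) : Prop :=
  forall D : nat -> set Y, (forall n, dense (D n)) ->
    (forall n, reply s D n `<=` D n /\ discrete_subset (reply s D n)) /\
    (forall U : set Y, open U -> U !=set0 ->
       finite_set [set n | ~ (U `&` reply s D n !=set0)]).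

Definition DHplus_separable (Y : topologicalType) : Prop :=
  exists s : strategy_Two Y, winning_DHplus s.

(* Main.v *)
(** Let [K] be the set of all subsets of [X] with the discrete topology, and let
    [Z] be the countable power of [K].  For each [n] the open boxes [O * C], with
    [O] open in [X] and [C] a cylinder of length [n.+1] whose last letter is [O],
    are pairwise disjoint, since that letter is read off [C].  An open set
    containing [O * C'] with [C'] of length [m] includes a box of every level
    [n >= m]: extend [C'] arbitrarily to length [n] and append the letter [O].
    So Two wins by choosing one point of [D_n] in each box of level [n]: the
    choice is discrete because the boxes are disjoint. *)
Require Import Defs.
From mathcomp Require Import all_boot all_order all_algebra.
From mathcomp Require Import all_classical all_reals all_analysis.
Local Open Scope classical_set_scope.

Lemma isolated_discrete_subset (T : topologicalType) (A : set T) :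
  (forall a, A a -> exists V, [/\ open V, V a & V `&` A `<=` [set a]]) ->
  discrete_subset A.
Proof.
move=> isoA U; rewrite openE => a Ua.
have [V [oV Va VA]] := isoA _ (set_valP a).
have /filterS : nbhs a (set_val @^-1` V : set (set_type A)).
  by apply: open_nbhs_nbhs; split => //; exists V.
apply=> b /= Vb.
suff -> : b = a by [].
by apply: val_inj; apply: VA; split => //; exact: set_valP.
Qed.

(** Returning a set rather than a point lets [c] be empty on the empty set, so [T] may be empty. *)
Lemma choose_subset1 (T : Type) : exists c : set T -> set T,
  forall A, [/\ c A `<=` A, is_subset1 (c A) & A !=set0 -> c A !=set0].
Proof.
suff /choice [c cP] : forall A : set T, exists B : set T,
    [/\ B `<=` A, is_subset1 B & A !=set0 -> B !=set0] by exists c.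
move=> A; have [[a Aa]|A0] := pselect (A !=set0).
  by exists [set a]; split=> [x ->|x y -> ->|_] //; exists a.
by exists set0; split.
Qed.

Lemma disjoint_families_DHplus (Y : topologicalType) (B : nat -> set (set Y)) :
  (forall n V, B n V -> open V) ->
  (forall n V W, B n V -> B n W -> V `&` W !=set0 -> V = W) ->
  (forall U, open U -> U !=set0 -> exists m, forall n, (m <= n)%N ->
     exists V, [/\ B n V, V !=set0 & V `<=` U]) ->
  DHplus_separable Y.
Proof.
move=> openB disjB piB; have [c cP] := choose_subset1 Y.
(* At inning [n] the history has length [n.+1], hence the predecessor. Only the last move of One
   matters. *)
pose s : strategy_Two Y :=
  fun h => \bigcup_(V in B (size h).-1) c (V `&` last set0 h).
exists s => D dD.
have replyE n : reply s D n = \bigcup_(V in B n) c (V `&` D n).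
  by rewrite /reply /s -nth_last size_mkseq /= nth_mkseq.
split=> [n|U oU U0].
  rewrite replyE; split=> [y [V _]|].
    by have [sub _ _] := cP (V `&` D n) => /sub[].
  apply: isolated_discrete_subset => y [V BV cy].
  have [sub sub1 _] := cP (V `&` D n); have [Vy _] := sub _ cy.
  exists V; split=> [||x [Vx [W BW cx]]] //; first exact: openB BV.
  have VW : V = W.
    apply: disjB BV BW _; exists x; split=> //.
    by have [subW _ _] := cP (W `&` D n); have [] := subW _ cx.
  by apply: sub1 => //; rewrite VW.
have [m mP] := piB _ oU U0.
apply: sub_finite_set (finite_II m) => n /= nU.
rewrite ltnNge; apply/negP => /mP[V [BV V0 VU]]; apply: nU.
have [sub _ ne] := cP (V `&` D n).
have [y cy] := ne (dD n _ V0 (openB _ _ BV)).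
have [Vy _] := sub _ cy.
by exists y; split; [exact: VU | rewrite replyE; exists V].
Qed.

Definition cylinder {K : topologicalType} (n : nat) (z : {ptws nat -> K}) :
  set {ptws nat -> K} := [set w | forall i, (i < n)%N -> w i = z i].

Lemma cylinder_open (K : discreteTopologicalType) n (z : {ptws nat -> K}) :
  open (cylinder n z).
Proof.
elim: n => [|n IHn].
  by rewrite (_ : cylinder _ _ = setT); [exact: openT | exact/seteqP].
rewrite (_ : cylinder _ _ =
  cylinder n z `&` (@proj _ (fun=> K) n @^-1` [set z n])).
  apply: openI => //; apply: open_comp; last exact: discrete_open.
  by move=> w _; exact: (@proj_continuous _ (fun=> K)).
apply/seteqP; split=> [w wz|w [wz wn] i].
  by split=> [i /ltnW|]; [exact: wz | exact: wz].
by rewrite ltnS leq_eqVlt => /predU1P[->|/wz].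
Qed.

(** The product topology is a supremum of initial topologies, so the filter of cylinders need only
    be compared with one coordinate at a time; length [i.+1] fixes coordinate [i]. *)
Lemma nbhs_cylinder (K : topologicalType) (z : {ptws nat -> K}) N :
  nbhs z N -> exists n, cylinder n z `<=` N.
Proof.
pose F := filter_from [set: nat] (fun n => cylinder n z).
have FF : Filter F.
  apply: filter_from_filter; first by exists 0%N.
  move=> i j _ _; exists (maxn i j) => // w wz; split=> k kn; apply: wz.
    by rewrite leq_max kn.
  by rewrite leq_max kn orbT.
suff Fz : F --> z by move=> /Fz [n _ nN]; exists n.
apply/cvg_sup => i U [V [[W oW <-] Wz WU]].
by exists i.+1 => // w wz; apply: WU; rewrite /= wz.
Qed.

(* The library's [uniform_completely_regular] is parameterized by a [realType],
   and instantiating it would bring in the axioms of a concrete one. *)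
Lemma uniform_space_completely_regular (T : uniformType) :
  completely_regular_space T.
Proof.
move=> a B cB nBa.
have : nbhs a (~` B) by apply: open_nbhs_nbhs; split=> //; exact: closed_openC.
rewrite -nbhs_entourageE => -[E entE EB].
(* The uniformity of [T] itself separates: the section of [E] at [a] misses [B]. *)
exists (Uniform.class T), E; split=> [//||x A //].
rewrite -subset0 => -[_ b] [[/= -> Bb] Eab].
by apply: (EB b) => //; exact/xsectionP.
Qed.

Lemma discrete_power_tychonoff (K : choiceType) :
  tychonoff_space {ptws nat -> discrete_topology K}.
Proof.
split; first by apply: hausdorff_product => _; exact: discrete_hausdorff.
exact: uniform_space_completely_regular.
Qed.

Theorem theorem37 (X : topologicalType) :
  exists Z : topologicalType,
    [/\ [set: Z] !=set0, tychonoff_space Z & DHplus_separable (X * Z)%type].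
Proof.
pose K : discreteTopologicalType := discrete_topology (set X).
exists {ptws nat -> K}; split.
- by exists (fun=> set0).
- exact: discrete_power_tychonoff.
apply: (@disjoint_families_DHplus (X * {ptws nat -> K})%type (fun n =>
  [set (z n : set X) `*` cylinder n.+1 z |
    z in [set z : {ptws nat -> K} | open (z n : set X)]])).
- move=> n _ [z oz <-]; rewrite openE => -[x w] [/= zx wz].
  exists ((z n : set X), cylinder n.+1 z) => //; split.
    exact: open_nbhs_nbhs.
  by apply: open_nbhs_nbhs; split => //; exact: cylinder_open.
- move=> n _ _ [z _ <-] [z' _ <-] [[x w] [[_ /= wz] [_ /= wz']]].
  (* A common point makes the two words agree up to index [n], so both factors of the boxes
     coincide. *)
  have zz' i : (i < n.+1)%N -> z i = z' i by move=> lin; rewrite -wz// -wz'.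
  rewrite zz'//; congr (_ `*` _).
  by apply/seteqP; split=> v vz i lin; rewrite vz// zz'.
- move=> U oU [[x z] Uxz].
  have [[N M] [/= nN /nbhs_cylinder[m mM] NMU]] : nbhs (x, z) U.
    exact: open_nbhs_nbhs.
  exists m => n lemn.
  (* The letter at index [n] must be open, hence the interior of [N]; later letters lie outside the
     cylinder's reach. *)
  pose z' : {ptws nat -> K} := fun i => if (i < n)%N then z i else N°.
  have z'n : z' n = N° by rewrite /z' ltnn.
  exists ((z' n : set X) `*` cylinder n.+1 z'); split.
  + by exists z' => //=; rewrite z'n; exact: open_interior.
  + by exists (x, z'); split=> //=; rewrite z'n.
  + move=> [y w] [/=]; rewrite z'n => /interior_subset Ny wz'.
    apply: NMU; split=> //=; apply: mM => i lim.
    have lin := leq_trans lim lemn.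
    by rewrite wz' ?leqW// /z' lin.
Qed.
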